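(* For all Boolean functions $f:\{0,1\}^n\times\{0,1\}^n\to\{0,1\}$: $PC(f)=\Theta(QC(f))$.
   Context: A (classical, resp. quantum) weakly unbounded error protocol for $f$ is a two-party protocol (Alice holds $x$, Bob holds $y$) whose output is correct with probability exceeding $1/2$ on every input; if its worst-case error is $1/2-\delta$ and worst-case communication is $c$ (bits, resp. qubits), its cost is $c-\lfloor\log\delta\rfloor$ ($\log$ base 2). Classical protocols use private random bits. Quantum protocols are in Yao's model without prior entanglement: each player holds private qubits initialized to the input and $|0\rangle$; in each round one player applies a unitary to his qubits and sends one qubit; at the end a qubit is measured giving the output. $PC(f)$ (resp. $QC(f)$) is the minimum cost of a classical (resp. quantum) weakly unbounded error protocol for $f$. *)

(* Defs.v *)
From HB Require Import structures.
From mathcomp Require Import all_boot all_order all_algebra.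
From mathcomp Require Import boolp reals exp complex.
Set Implicit Arguments. Unset Strict Implicit. Unset Printing Implicit Defensive.
Import Order.TTheory GRing.Theory Num.Theory.
Local Open Scope ring_scope.

Definition bits (n : nat) := (n.-tuple bool).

(* least natural number satisfying a (classical) property, 0 if none *)
Definition natmin (P : nat -> Prop) : nat :=
  match pselect (exists k, P k) with
  | left h => @ex_minn (fun k => `[< P k >])
                (let: ex_intro k hk := h in ex_intro _ k (asboolT hk))
  | right _ => 0%N
  end.

(* pc x y = probability that the protocol outputs the correct value.   *)
Section Cost.
Variables (R : realType) (n : nat).

Definition weakly_unbounded (pc : bits n -> bits n -> R) : Prop :=
  forall x y, 1 / 2 < pc x y.

(* delta = 1/2 - (worst-case error) = min_{x,y} (Pr[correct] - 1/2) *)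
Definition wdelta (pc : bits n -> bits n -> R) : R :=
  \big[Num.min/1]_(xy : bits n * bits n) (pc xy.1 xy.2 - 1 / 2).

Definition wcost (c : nat) (pc : bits n -> bits n -> R) : int :=
  c%:Z - Num.floor (ln (wdelta pc) / ln 2).
End Cost.

(* Alice holds (x, ra), Bob holds (y, rb).  A protocol is a tree: at a  *)
(* node the owner sends one bit computed from his input and his random  *)
(* string; at a leaf one player outputs a bit computed from his data.   *)
Inductive cprot (X Y RA RB : Type) : Type :=
| CLeafA of (X -> RA -> bool)
| CLeafB of (Y -> RB -> bool)
| CNodeA of (X -> RA -> bool) & cprot X Y RA RB & cprot X Y RA RB
| CNodeB of (Y -> RB -> bool) & cprot X Y RA RB & cprot X Y RA RB.

Section Classical.
Variables (X Y RA RB : Type).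

Fixpoint crun (p : cprot X Y RA RB) x y ra rb : bool :=
  match p with
  | CLeafA o => o x ra
  | CLeafB o => o y rb
  | CNodeA m p0 p1 => if m x ra then crun p1 x y ra rb else crun p0 x y ra rb
  | CNodeB m p0 p1 => if m y rb then crun p1 x y ra rb else crun p0 x y ra rb
  end.

Fixpoint cbits (p : cprot X Y RA RB) x y ra rb : nat :=
  match p with
  | CLeafA _ | CLeafB _ => 0%N
  | CNodeA m p0 p1 => (if m x ra then cbits p1 x y ra rb else cbits p0 x y ra rb).+1
  | CNodeB m p0 p1 => (if m y rb then cbits p1 x y ra rb else cbits p0 x y ra rb).+1
  end.
End Classical.

Section ClassicalCost.
Variables (R : realType) (n ka kb : nat).
Local Notation CP := (cprot (bits n) (bits n) (ka.-tuple bool) (kb.-tuple bool)).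

Definition ccomm (p : CP) : nat :=
  \max_(w : (bits n * bits n) * (ka.-tuple bool * kb.-tuple bool))
     cbits p w.1.1 w.1.2 w.2.1 w.2.2.

Definition cpcorrect (f : bits n -> bits n -> bool) (p : CP) (x y : bits n) : R :=
  (#|[set r : ka.-tuple bool * kb.-tuple bool | crun p x y r.1 r.2 == f x y]|)%:R
  / (#|{: ka.-tuple bool * kb.-tuple bool}|)%:R.
End ClassicalCost.

Definition PC (R : realType) (n : nat) (f : bits n -> bits n -> bool) : nat :=
  natmin (fun k => exists (ka kb : nat)
     (p : cprot (bits n) (bits n) (ka.-tuple bool) (kb.-tuple bool)),
     weakly_unbounded (cpcorrect R f p) /\
     (wcost (ccomm p) (cpcorrect R f p) <= k%:Z)).

(* Quantum protocols in Yao's model (no prior entanglement).            *)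
(* Qubits: inl i (i < n + ka) initially Alice's, inr j initially Bob's; *)
(* Alice's first n qubits hold x, Bob's first n hold y, the rest |0>.   *)
(* Ownership of a qubit changes when it is sent.                        *)
Section Quantum.
Variables (R : realType) (n ka kb : nat).

Definition qubit := ('I_(n + ka) + 'I_(n + kb))%type.
Definition qconf := {ffun qubit -> bool}.   (* computational basis states *)
Local Notation C := (R[i]).
Definition qop := qconf -> qconf -> C.

Definition qapply (U : qop) (psi : qconf -> C) : qconf -> C :=
  fun z => \sum_(z' : qconf) U z z' * psi z'.

Definition unitary (U : qop) : Prop :=
  forall z z', \sum_(w : qconf) (U w z)^* * U w z' = (z == z')%:R.

(* U acts only on the qubits in S, i.e. U = U_S (x) Id_{not S} *)
Definition acts_only_on (S : pred qubit) (U : qop) : Prop :=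
  (forall z z' : qconf, (exists q, ~~ S q /\ z q != z' q) -> U z z' = 0) /\
  (forall z z' w w' : qconf,
     (forall q, S q -> z q = w q /\ z' q = w' q) ->
     (forall q, ~~ S q -> z q = z' q /\ w q = w' q) ->
     U z z' = U w w').

(* a round: speaker (true = Alice, false = Bob) applies a unitary to
   the qubits he owns, then sends one of his qubits *)
Record qround := QRound { q_speaker : bool; q_U : qop; q_sent : qubit }.

Record qprot := QProt { q_rounds : seq qround; q_out : qubit }.

Definition owner0 (q : qubit) : bool := if q is inl _ then true else false.

Fixpoint qvalid_from (own : qubit -> bool) (rs : seq qround) : Prop :=
  match rs with
  | [::] => True
  | r :: rs' =>
      [/\ unitary (q_U r),
          acts_only_on (fun q => own q == q_speaker r) (q_U r),
          own (q_sent r) = q_speaker r &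
          qvalid_from (fun q => if q == q_sent r then ~~ own q else own q) rs']
  end.

Definition qvalid (p : qprot) : Prop := qvalid_from owner0 (q_rounds p).

Definition qinit_conf (x y : bits n) : qconf :=
  [ffun q : qubit => match q with inl i => nth false x (val i) | inr j => nth false y (val j) end].

Definition qinit (x y : bits n) : qconf -> C :=
  fun z => (z == qinit_conf x y)%:R.

Definition qfinal (p : qprot) (x y : bits n) : qconf -> C :=
  foldl (fun psi r => qapply (q_U r) psi) (qinit x y) (q_rounds p).

Definition sqmod (c : C) : R := complex.Re c ^+ 2 + complex.Im c ^+ 2.

(* communication = number of rounds = number of qubits sent *)
Definition qcomm (p : qprot) : nat := size (q_rounds p).

Definition qpcorrect (f : bits n -> bits n -> bool) (p : qprot) (x y : bits n) : R :=
  \sum_(z : qconf | z (q_out p) == f x y) sqmod (qfinal p x y z).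
End Quantum.

Definition QC (R : realType) (n : nat) (f : bits n -> bits n -> bool) : nat :=
  natmin (fun k => exists (ka kb : nat) (p : qprot R n ka kb),
     qvalid p /\ weakly_unbounded (qpcorrect f p) /\
     (wcost (qcomm p) (qpcorrect f p) <= k%:Z)).

(* Main.v *)
Require Import Defs.
From mathcomp Require Import all_boot all_order all_algebra.
From mathcomp Require Import boolp reals exp complex.
From mathcomp Require Import ring lra zify.

Set Implicit Arguments.
Unset Strict Implicit.
Unset Printing Implicit Defensive.
Import Order.TTheory GRing.Theory Num.Theory.
Local Open Scope ring_scope.

(* Both kinds of protocols are equivalent to a bilinear form: there are
   [a x i, b y i] in [-1, 1], with [i] ranging over [2 ^ O(c)] indices, such that
   [\sum_i a x i * b y i] has the sign of [f x y] and absolute value at least a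
   constant times the bias. Since the cost is the communication plus the logarithm
   of the inverse bias, losing a factor [2 ^ O(c)] in the bias is harmless.
   - A classical protocol gives the form by summing over transcripts.
   - For a quantum protocol (Yao, Kremer) the final state is a sum of [2 ^ c] products
     of one state of Alice and one of Bob, of norm at most 1; the bias expands into
     the [4 ^ c] products of the mutual inner products of these states.
   - Conversely, on a common random [i] one player announces a sign of mean [a x i]
     and the other multiplies it by a sign of mean [b y i]. Classically the means
     are rounded to dyadic numbers, because only fair coins are available. *)

(** * Minimal costs *)

Lemma natminP (P : nat -> Prop) k : P k -> P (natmin P) /\ (natmin P <= k)%N.
Proof.
move=> Pk; rewrite /natmin; case: pselect => [h|[]]; last by exists k.
case: ex_minnP => j /asboolP Pj jmin; split=> //.
by apply: jmin; apply/asboolP.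
Qed.

(** The second hypothesis handles the default value: if no [k] satisfies [P], then [natmin P] is 0,
    and [natmin Q] has to be 0 as well. *)
Lemma natmin_leM (P Q : nat -> Prop) K :
    (forall k, P k -> exists2 l, Q l & (l <= K * k)%N) ->
    (forall l, Q l -> exists k, P k) ->
  (natmin Q <= K * natmin P)%N.
Proof.
move=> PQ QP.
have [[k /natminP[/PQ[l /natminP[_ Ql] lK] _]]|nP] := pselect (exists k, P k).
  exact: leq_trans Ql lK.
rewrite /natmin; case: pselect => // -[l /QP /nP//].
Qed.

(** * Bias and cost *)

Section Cost.
Variables (R : realType) (n : nat).
Implicit Types pc : bits n -> bits n -> R.

Lemma wdelta_le pc x y : wdelta pc <= pc x y - 1 / 2.
Proof. exact: (bigmin_le _ (x, y)). Qed.

Lemma wdelta_gt0 pc : weakly_unbounded pc -> 0 < wdelta pc.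
Proof.
by move=> pcP; apply/bigmin_gtP; split=> // -[x y] _; rewrite subr_gt0 pcP.
Qed.

Lemma le_wdelta pc d : d <= 1 -> (forall x y, d <= pc x y - 1 / 2) ->
  d <= wdelta pc.
Proof. by move=> d1 dpc; apply/bigmin_geP; split. Qed.

(** Success probabilities at most 1 force a bias at most 1/2, so the logarithmic part of the cost is
    at least 1. This unit later absorbs additive constants into the multiplicative one. *)
Lemma floor_log_wdelta pc : weakly_unbounded pc -> (forall x y, pc x y <= 1) ->
  Num.floor (ln (wdelta pc) / ln 2) <= -1.
Proof.
move=> pcW pc1.
have ln2 : 0 < ln (2 : R) by rewrite ln_gt0// ltr1n.
have dhalf : wdelta pc <= 2^-1.
  have := wdelta_le pc [tuple of nseq n false] [tuple of nseq n false].
  have := pc1 [tuple of nseq n false] [tuple of nseq n false]; lra.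
have : ln (wdelta pc) / ln 2 <= -1.
  rewrite ler_pdivrMr// mulN1r -lnV ?posrE//.
  by rewrite ler_ln ?posrE ?invr_gt0// wdelta_gt0.
move=> /le_floor /le_trans; apply.
by rewrite floorN ?rpred1// floor1.
Qed.

(** The logarithm turns a loss of a factor [2 ^ j] in the bias into an additive [j], and an integer
    passes through the floor. Here [c] is the communication of the new protocol. *)
Lemma wcost_le pc pc' c j : weakly_unbounded pc -> (forall x y, pc x y <= 1) ->
    (forall x y, 1 / 2 + wdelta pc / 2 ^+ j <= pc' x y) ->
  weakly_unbounded pc' /\
  wcost c pc' <= c%:Z + j%:Z - Num.floor (ln (wdelta pc) / ln 2).
Proof.
move=> pcW pc1 pc'P.
have ln2 : 0 < ln (2 : R) by rewrite ln_gt0// ltr1n.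
have d0 := wdelta_gt0 pcW.
have d'0 : 0 < wdelta pc / 2 ^+ j by rewrite divr_gt0// exprn_gt0.
have le_d : wdelta pc / 2 ^+ j <= wdelta pc'.
  (* The minimum in [wdelta] starts from 1, so any lower bound for it must also be at most 1. *)
  apply: le_wdelta => [|x y]; last by rewrite lerBrDl.
  rewrite ler_pdivrMr ?exprn_gt0// mul1r (@le_trans _ _ 1)//.
    exact: bigmin_le_id.
  by rewrite exprn_ege1// ler1n.
split=> [x y|].
  by apply: lt_le_trans (pc'P x y); rewrite ltrDl.
suff : Num.floor (ln (wdelta pc) / ln 2) - j%:Z
     <= Num.floor (ln (wdelta pc') / ln 2) by rewrite /wcost; lia.
rewrite -[j%:Z](@intrKfloor R) -floorN ?intr_int// -floorDrz ?rpredN ?intr_int//.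
apply: le_floor; rewrite -pmulrn.
have -> : j%:R = ln (2 ^+ j : R) / ln 2.
  by rewrite lnXn// -[ln 2 *+ j]mulr_natl mulfK// gt_eqF.
rewrite -mulrBl -ln_div ?posrE ?exprn_gt0// ler_pM2r ?invr_gt0//.
by rewrite ler_ln ?posrE// (lt_le_trans d'0).
Qed.

End Cost.

(** The cardinality of [I], whose logarithm stands for the communication, is recorded separately. *)
Definition bilinear (R : realType) n (f : bits n -> bits n -> bool)
    (I : finType) (th : R) : Prop :=
  exists a b : bits n -> I -> R,
    [/\ forall x i, `|a x i| <= 1, forall y i, `|b y i| <= 1 &
        forall x y, th <= (-1) ^+ f x y * \sum_i a x i * b y i].

(** * From classical protocols to bilinear forms *)

Section ClassicalToBilinear.
Variable R : realType.

Lemma crun_sign_decomposition (X Y RA RB : Type) (p : cprot X Y RA RB) m :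
  exists (a : X -> RA -> m.-tuple bool -> R) (b : Y -> RB -> m.-tuple bool -> R),
    [/\ forall x ra i, `|a x ra i| <= 1, forall y rb i, `|b y rb i| <= 1 &
        forall x y ra rb, (cbits p x y ra rb <= m)%N ->
          (-1) ^+ crun p x y ra rb = \sum_i a x ra i * b y rb i].
Proof.
pose t0 k : k.-tuple bool := [tuple of nseq k false].
have leb (b : bool) (r : R) : `|r| <= 1 -> `|b%:R * r| <= 1.
  by case: b => r1; rewrite ?mul1r ?mul0r ?normr0.
have sg1 (b : bool) : `|(-1) ^+ b : R| <= 1 by rewrite normrX normrN1 expr1n.
have sum_t0 k (F G : k.-tuple bool -> R) :
    \sum_i ((i == t0 k)%:R * F i) * ((i == t0 k)%:R * G i) = F (t0 k) * G (t0 k).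
  rewrite (bigD1 (t0 k))//= !eqxx !mul1r big1 ?addr0// => i /negPf->.
  by rewrite !mul0r.
have sum_tS k (F : k.+1.-tuple bool -> R) :
    \sum_i F i = \sum_(i : k.-tuple bool) (F [tuple of false :: i] + F [tuple of true :: i]).
  rewrite big_split/=.
  rewrite (reindex (fun u : bool * k.-tuple bool => [tuple of u.1 :: u.2]))/=; last first.
    exists (fun i => (thead i, [tuple of behead i])) => [[b i] _|i _]/=.
      by congr pair; apply/val_inj.
    by case/tupleP: i => b i; apply/val_inj; rewrite /= theadE.
  rewrite -(pair_bigA _ (fun b (i : k.-tuple bool) => F [tuple of b :: i]))/=.
  by rewrite big_bool addrC.
have beheadK k (b : bool) (i : k.-tuple bool) :
    [tuple of behead [tuple of b :: i]] = i by apply/val_inj.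
elim: p m => [o|o|o p0 IH0 p1 IH1|o p0 IH0 p1 IH1] m.
- exists (fun x ra i => (i == t0 m)%:R * (-1) ^+ o x ra), (fun _ _ i => (i == t0 m)%:R * 1).
  split=> [x ra i|y rb i|x y ra rb _]; rewrite ?leb ?normr1 ?sg1//.
  by rewrite (sum_t0 m (fun=> _)) mulr1.
- exists (fun _ _ i => (i == t0 m)%:R * 1), (fun x ra i => (i == t0 m)%:R * (-1) ^+ o x ra).
  split=> [x ra i|y rb i|x y ra rb _]; rewrite ?leb ?normr1 ?sg1//.
  by rewrite (sum_t0 m (fun=> _) (fun=> _)) mul1r.
- case: m => [|m].
    (* A node costs one bit, so no run meets the bound 0 and zero vectors suffice. *)
    exists (fun _ _ _ => 0), (fun _ _ _ => 0).
    by split=> [x ra i|y rb i|x y ra rb]; rewrite ?normr0.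
  have [a0 [b0 [a0le b0le ab0]]] := IH0 m; have [a1 [b1 [a1le b1le ab1]]] := IH1 m.
  (* The first bit of [i] is the message: the speaker's factor vanishes unless it is the bit sent,
     and the listener follows the branch it names. *)
  exists (fun x ra i => (o x ra == thead i)%:R *
            (if thead i then a1 else a0) x ra [tuple of behead i]),
         (fun y rb i => (if thead i then b1 else b0) y rb [tuple of behead i]).
  split=> [x ra i|y rb i|x y ra rb /=]; first by apply: leb; case: ifP.
    by case: ifP.
  rewrite ltnS sum_tS => le_m.
  under eq_bigr => i _.
    rewrite !theadE !beheadK; over.
  case: (o x ra) le_m => /= [/ab1->|/ab0->]; apply: eq_bigr => i _;
    by rewrite !mul0r ?addr0 ?add0r mul1r.
- case: m => [|m].
    exists (fun _ _ _ => 0), (fun _ _ _ => 0).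
    by split=> [x ra i|y rb i|x y ra rb]; rewrite ?normr0.
  have [a0 [b0 [a0le b0le ab0]]] := IH0 m; have [a1 [b1 [a1le b1le ab1]]] := IH1 m.
  exists (fun x ra i => (if thead i then a1 else a0) x ra [tuple of behead i]),
         (fun y rb i => (o y rb == thead i)%:R *
            (if thead i then b1 else b0) y rb [tuple of behead i]).
  split=> [x ra i|y rb i|x y ra rb /=]; first by case: ifP.
    by apply: leb; case: ifP.
  rewrite ltnS sum_tS => le_m.
  under eq_bigr => i _.
    rewrite !theadE !beheadK; over.
  case: (o y rb) le_m => /= [/ab1->|/ab0->]; apply: eq_bigr => i _;
    by rewrite !mul0r mul1r mulr0 ?addr0 ?add0r.
Qed.

Lemma sum_signr_card (T : finType) (g : T -> bool) (b : bool) :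
  (-1) ^+ b * \sum_t (-1) ^+ g t = (#|[set t | g t == b]|)%:R *+ 2 - #|T|%:R :> R.
Proof.
rewrite mulr_sumr -sum1dep_card -sum1_card !natr_sum -sumrMnl.
rewrite [X in _ = X - _]big_mkcond/= -sumrB; apply: eq_bigr => t _.
by case: (g t) b => -[]/=; rewrite ?expr0 ?expr1; lra.
Qed.

Section Protocol.
Variables (n ka kb : nat) (f : bits n -> bits n -> bool).
Variable p : cprot (bits n) (bits n) (ka.-tuple bool) (kb.-tuple bool).
Local Notation RND := (ka.-tuple bool * kb.-tuple bool)%type.

Lemma cpcorrect_le1 x y : cpcorrect R f p x y <= 1.
Proof.
rewrite /cpcorrect ler_pdivrMr ?mul1r ?ler_nat ?max_card// ltr0n.
by rewrite card_prod !card_tuple muln_gt0 !expn_gt0 card_bool.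
Qed.

Lemma cpcorrectE x y : cpcorrect R f p x y * 2 - 1 =
  (-1) ^+ f x y * ((\sum_(r : RND) (-1) ^+ crun p x y r.1 r.2) / #|{: RND}|%:R).
Proof.
have N0 : #|{: RND}|%:R != 0 :> R.
  by rewrite pnatr_eq0 card_prod !card_tuple muln_eq0 !expn_eq0 card_bool.
by rewrite mulrA sum_signr_card /cpcorrect -mulr_natr; field.
Qed.

(** The coins of the two players are independent, so averaging turns each product into a product of
    two averages, one per player. The factor 2 comes from passing from a success probability [p] to
    the mean [2 p - 1] of a sign. *)
Lemma classical_bilinear :
  bilinear f {: (ccomm p).-tuple bool} (wdelta (cpcorrect R f p) * 2).
Proof.
have [a [b [ale ble ab]]] := crun_sign_decomposition p (ccomm p).
have E1 k (F : k.-tuple bool -> R) : (forall r, `|F r| <= 1) ->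
    `|(\sum_r F r) / #|{: k.-tuple bool}|%:R| <= 1.
  have N0 : 0 < #|{: k.-tuple bool}|%:R :> R.
    by rewrite ltr0n card_tuple expn_gt0 card_bool.
  move=> F1; rewrite normrM normfV (gtr0_norm N0) ler_pdivrMr// mul1r.
  apply: le_trans (ler_norm_sum _ _ _) _.
  by rewrite -sum1_card natr_sum ler_sum.
exists (fun x i => (\sum_r a x r i) / #|{: ka.-tuple bool}|%:R),
       (fun y i => (\sum_r b y r i) / #|{: kb.-tuple bool}|%:R).
split=> [x i|y i|x y]; [exact: E1|exact: E1|].
apply: (@le_trans _ _ (cpcorrect R f p x y * 2 - 1)).
  by have := wdelta_le (cpcorrect R f p) x y; lra.
rewrite cpcorrectE le_eqVlt; apply/orP; left; apply/eqP; congr (_ * _).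
rewrite card_prod natrM invfM mulr_suml.
transitivity (\sum_(r : RND) \sum_i
   (a x r.1 i / #|{: ka.-tuple bool}|%:R) * (b y r.2 i / #|{: kb.-tuple bool}|%:R)).
  apply: eq_bigr => -[ra rb] _ /=; rewrite ab ?mulr_suml; last first.
    exact: (@leq_bigmax_cond _ predT (fun w : (bits n * bits n) * RND =>
      cbits p w.1.1 w.1.2 w.2.1 w.2.2) ((x, y), (ra, rb))).
  by apply: eq_bigr => i _; rewrite mulrACA.
rewrite exchange_big/=; apply: eq_bigr => i _.
rewrite !mulr_suml; under [RHS]eq_bigr => ra _ do rewrite mulr_sumr.
by rewrite pair_bigA.
Qed.

End Protocol.
End ClassicalToBilinear.

(** * From bilinear forms to classical protocols *)

Lemma card_eq_bij (T1 T2 : finType) : #|T1| = #|T2| ->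
  exists f : T1 -> T2, bijective f.
Proof.
move=> e; exists (fun t => enum_val (cast_ord e (enum_rank t))).
exists (fun t => enum_val (cast_ord (esym e) (enum_rank t))) => t.
  by rewrite enum_valK cast_ordK enum_rankK.
by rewrite enum_valK cast_ordKV enum_rankK.
Qed.

Section BilinearToClassical.
Variable R : realType.

(* [threshold a] is a bit computed from [r] fair coins whose sign has mean [a]
   up to [2 / 2 ^ r]. *)
Definition threshold r (a : R) (u : 'I_(2 ^ r)) : bool :=
  (Num.truncn (2 ^+ r * (1 + a) / 2) <= u)%N.

(** Exactly [t] of the [2 ^ r] values give the sign 1, so the mean is [2 t / 2 ^ r - 1]; truncating
    [2 ^ r (1 + a) / 2] to [t] loses less than one value. *)
Lemma threshold_mean r (a : R) : `|a| <= 1 ->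
  `|(\sum_(u : 'I_(2 ^ r)) (-1) ^+ threshold a u) / 2 ^+ r - a| <= 2 / 2 ^+ r.
Proof.
rewrite ler_norml => /andP[aN1 a1].
have r0 : 0 < 2 ^+ r :> R by rewrite exprn_gt0.
have v0 : 0 <= 2 ^+ r * (1 + a) / 2 by rewrite divr_ge0// mulr_ge0//; lra.
set t := Num.truncn (2 ^+ r * (1 + a) / 2).
have /andP[tle ltt] := truncn_itv v0; rewrite -/t in tle ltt.
have le_t : (t <= 2 ^ r)%N.
  rewrite -(ler_nat R) natrX; apply: le_trans tle _.
  by rewrite ler_pdivrMr// ler_pM2l// -[2]/(1 + 1) lerD2l.
have -> : \sum_(u : 'I_(2 ^ r)) (-1) ^+ threshold a u = t%:R *+ 2 - 2 ^+ r :> R.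
  rewrite -[LHS]mul1r -[1 in LHS](expr0 (-1)) (sum_signr_card _ _ false).
  rewrite card_ord natrX; congr (_%:R *+ 2 - _).
  rewrite -sum1dep_card (eq_bigl (fun u : 'I__ => (u < t)%N)) => [|u].
    by rewrite -(big_ord_widen _ (fun=> 1%N))// sum1_card card_ord.
  by rewrite /threshold -/t eqbF_neg -ltnNge.
have -> : (t%:R *+ 2 - 2 ^+ r) / 2 ^+ r - a =
          (t%:R - 2 ^+ r * (1 + a) / 2) * 2 / 2 ^+ r.
  by rewrite -mulr_natr; field; rewrite gt_eqF.
rewrite normrM normfV (gtr0_norm r0) ler_pM2r ?invr_gt0//.
rewrite normrM [`|2|]gtr0_norm// ler_piMl// ler_norml.
rewrite -[t.+1%:R]natr1 in ltt; rewrite lerNl opprB lerBlDl (ltW ltt) lerBlDr.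
by rewrite (le_trans tle)// lerDr.
Qed.

Section Send.
Variables X Y RA RB : Type.

(** The tree has one copy of the remaining protocol for each sequence of messages, so the
    continuation is a function of the bits sent. *)
Fixpoint sendA (ms : seq (X -> RA -> bool)) (cont : seq bool -> cprot X Y RA RB) :=
  if ms is m :: ms' then
    CNodeA m (sendA ms' (cont \o cons false)) (sendA ms' (cont \o cons true))
  else cont [::].

Lemma crun_sendA ms cont x y ra rb : crun (sendA ms cont) x y ra rb =
  crun (cont [seq m x ra | m : X -> RA -> bool <- ms]) x y ra rb.
Proof. by elim: ms cont => //= m ms IH cont; rewrite !IH /=; case: (m x ra). Qed.

Lemma cbits_sendA ms cont x y ra rb : cbits (sendA ms cont) x y ra rb =
  (size ms + cbits (cont [seq m x ra | m : X -> RA -> bool <- ms]) x y ra rb)%N.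
Proof. by elim: ms cont => //= m ms IH cont; rewrite !IH /=; case: (m x ra). Qed.

End Send.

Lemma ler_norm_prodB (a b a' b' e : R) : `|b| <= 1 -> `|a'| <= 1 ->
  `|a' - a| <= e -> `|b' - b| <= e -> `|a' * b' - a * b| <= e *+ 2.
Proof.
move=> b1 a1 ae be; have -> : a' * b' - a * b = a' * (b' - b) + (a' - a) * b by ring.
rewrite mulr2n (le_trans (ler_normD _ _))// lerD// normrM.
  by rewrite (le_trans _ be)// ler_piMl.
by rewrite (le_trans _ ae)// ler_piMr.
Qed.

(** Alice sends her sign and the [m] bits of a random index. Averaging over the indices divides by
    [2 ^ m], rounding costs half of [th], and a last factor 2 separates a mean from a
    probability. *)
Lemma bilinear_classical n (f : bits n -> bits n -> bool) (I : finType) m (th : R) :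
    #|I| = (2 ^ m)%N -> 0 < th -> bilinear f I th ->
  exists ka kb (p : cprot (bits n) (bits n) (ka.-tuple bool) (kb.-tuple bool)),
    (ccomm p <= m.+1)%N /\
    forall x y, 1 / 2 + th / 2 ^+ m.+2 <= cpcorrect R f p x y.
Proof.
move=> cardI th0 [a [b [a1 b1 ab]]].
(* Each of the [2 ^ m] products is off by at most twice [2 / 2 ^ r]; this [r] keeps the total error
   below [th / 2]. *)
pose r := Num.bound (2 ^+ m.+3 / th).
have rP : 2 ^+ m * (2 / 2 ^+ r *+ 2) <= th / 2.
  have : 2 ^+ m.+3 / th < 2 ^+ r.
    apply: lt_trans (archi_boundP _) _; first by rewrite divr_ge0 ?exprn_ge0// ltW.
    by rewrite -/r -natrX ltr_nat ltn_expl.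
  rewrite ltr_pdivrMr// => /ltW le_th.
  have r0 : 0 < 2 ^+ r :> R by rewrite exprn_gt0.
  have -> : 2 ^+ m * (2 / 2 ^+ r *+ 2) = 2 ^+ m * 4 / 2 ^+ r :> R.
    by rewrite mulr2n; field; rewrite gt_eqF.
  rewrite ler_pdivrMr//.
  by move: le_th; rewrite !exprS; lra.
(* Coins are private, so Alice draws the index herself: her [m + r] coins are read as an index
   together with a position for [threshold]. *)
have [phiA [phiA' phiAK phiA'K]] : exists g : (m + r).-tuple bool -> I * 'I_(2 ^ r), bijective g.
  by apply: card_eq_bij; rewrite card_tuple card_prod card_bool card_ord cardI expnD.
have [phiB [phiB' phiBK phiB'K]] : exists g : r.-tuple bool -> 'I_(2 ^ r), bijective g.
  by apply: card_eq_bij; rewrite card_tuple card_bool card_ord.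
have [code [dec codeK decK]] : exists g : I -> m.-tuple bool, bijective g.
  by apply: card_eq_bij; rewrite card_tuple card_bool.
pose decs (s : seq bool) := dec [tuple nth false s k | k < m].
pose ms : seq (bits n -> (m + r).-tuple bool -> bool) :=
  (fun x ra => threshold (a x (phiA ra).1) (phiA ra).2) ::
  [seq fun _ ra => nth false (code (phiA ra).1) k | k <- iota 0 m].
pose p : cprot (bits n) (bits n) ((m + r).-tuple bool) (r.-tuple bool) :=
  sendA ms (fun s => CLeafB _ _
    (fun y rb => head false s (+) threshold (b y (decs (behead s))) (phiB rb))).
have pE x y ra rb : crun p x y ra rb =
    threshold (a x (phiA ra).1) (phiA ra).2 (+) threshold (b y (phiA ra).1) (phiB rb).
  rewrite /p crun_sendA /= -map_comp; congr (_ (+) threshold (b y _) _).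
  rewrite /decs -[RHS]codeK; congr dec; apply: eq_from_tnth => k.
  by rewrite tnth_mktuple (nth_map 0%N) ?size_iota//= nth_iota// (tnth_nth false).
have pC : (ccomm p <= m.+1)%N.
  by apply/bigmax_leqP => w _; rewrite cbits_sendA /= size_map size_iota addn0.
exists (m + r)%N, r, p; split=> // x y; clearbody p.
(* [ah] and [bh] are the means that the coins really produce. *)
pose ah i : R := (\sum_(u : 'I_(2 ^ r)) (-1) ^+ threshold (a x i) u) / 2 ^+ r.
pose bh i : R := (\sum_(u : 'I_(2 ^ r)) (-1) ^+ threshold (b y i) u) / 2 ^+ r.
suff main : th / 2 / 2 ^+ m <= cpcorrect R f p x y * 2 - 1.
  by rewrite -[_ <= _](ler_pM2r (ltr0n R 2)); move: main; rewrite !exprS !invfM; lra.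
rewrite cpcorrectE.
have -> : (\sum_rr (-1) ^+ crun p x y rr.1 rr.2) / #|{: (m + r).-tuple bool * r.-tuple bool}|%:R
   = (\sum_i ah i * bh i) / 2 ^+ m.
  rewrite card_prod !card_tuple card_bool natrM !natrX exprD.
  have -> : \sum_(rr : (m + r).-tuple bool * r.-tuple bool) (-1) ^+ crun p x y rr.1 rr.2
    = \sum_i (\sum_(u : 'I_(2 ^ r)) (-1) ^+ threshold (a x i) u) *
              (\sum_(u : 'I_(2 ^ r)) (-1) ^+ threshold (b y i) u) :> R.
    rewrite (reindex (fun w => (phiA' w.1, phiB' w.2)))/=; last first.
      by exists (fun w => (phiA w.1, phiB w.2)) => -[? ?] _ /=;
        rewrite ?phiAK ?phiBK ?phiA'K ?phiB'K.
    under eq_bigr => w _ do rewrite pE phiA'K phiB'K signr_addb.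
    rewrite -(pair_bigA _ (fun t (v : 'I_(2 ^ r)) =>
      (-1) ^+ threshold (a x t.1) t.2 * (-1) ^+ threshold (b y t.1) v))/=.
    rewrite -(pair_bigA _ (fun i (u : 'I_(2 ^ r)) =>
      \sum_(v : 'I_(2 ^ r)) (-1) ^+ threshold (a x i) u * (-1) ^+ threshold (b y i) v))/=.
    apply: eq_bigr => i _; rewrite mulr_suml; apply: eq_bigr => u _.
    by rewrite mulr_sumr.
  rewrite !mulr_suml; apply: eq_bigr => i _.
  rewrite /ah /bh; set A := \sum_u _; set B := \sum_u _.
  by field; rewrite !expf_neq0// pnatr_eq0.
rewrite mulrA ler_pM2r ?invr_gt0 ?exprn_gt0//.
have ah1 i : `|ah i| <= 1.
  rewrite /ah normrM normfV (gtr0_norm (exprn_gt0 _ _))// ler_pdivrMr ?exprn_gt0// mul1r.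
  apply: le_trans (ler_norm_sum _ _ _) _.
  rewrite -natrX -[X in _ <= X%:R](card_ord (2 ^ r)) -sum1_card natr_sum ler_sum// => u _.
  by rewrite normrX normrN1 expr1n.
have close : `|\sum_i ah i * bh i - \sum_i a x i * b y i| <= th / 2.
  rewrite -sumrB; apply: le_trans (ler_norm_sum _ _ _) _; apply: le_trans rP.
  rewrite -natrX -cardI mulr_natl -sumr_const ler_sum// => i _.
  by apply: ler_norm_prodB => //; exact: threshold_mean.
have := ab x y; move: close; rewrite ler_norml => /andP[].
by case: (f x y); rewrite ?expr0 ?expr1; lra.
Qed.

End BilinearToClassical.

(** * Norms, local operations and rotation gates *)

Section QuantumBasics.
Variables (R : realType) (n ka kb : nat).
Local Notation C := R[i].
Local Notation qb := (qubit n ka kb).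
Local Notation conf := (qconf n ka kb).
Local Notation op := (qop R n ka kb).
Implicit Types (U : op) (psi : conf -> C) (z w : conf) (q : qb).

Lemma sqmodE (c : C) : (sqmod c)%:C%C = c^* * c.
Proof.
case: c => a b; rewrite -[(Complex a b)^*]/(Complex a (- b)).
by apply/eqP; rewrite /sqmod eq_complex /=; apply/andP; split; apply/eqP; ring.
Qed.

Lemma sqmodM (c d : C) : sqmod (c * d) = sqmod c * sqmod d.
Proof. by case: c d => [a b] [a' b']; rewrite /sqmod /=; ring. Qed.

Lemma sqmod_real (r : R) : sqmod r%:C%C = r ^+ 2.
Proof. by rewrite /sqmod /= expr0n addr0. Qed.

Lemma sqmod_ge0 (c : C) : 0 <= sqmod c.
Proof. by rewrite addr_ge0 ?sqr_ge0. Qed.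

Lemma unitary_norm U psi : unitary U ->
  \sum_z sqmod (qapply U psi z) = \sum_z sqmod (psi z).
Proof.
move=> Uu; apply: (@complexI R); rewrite !rmorph_sum /=.
transitivity (\sum_z \sum_u \sum_v (psi u)^* * psi v * ((U z u)^* * U z v)).
  apply: eq_bigr => z _; rewrite sqmodE /qapply rmorph_sum mulr_suml.
  apply: eq_bigr => u _; rewrite mulr_sumr; apply: eq_bigr => v _.
  by rewrite rmorphM; ring.
rewrite exchange_big; apply: eq_bigr => u _; rewrite exchange_big /=.
under eq_bigr => v _ do rewrite -mulr_sumr Uu.
rewrite (bigD1 u)//= eqxx mulr1 big1 ?addr0 ?sqmodE// => v /negPf.
by rewrite eq_sym => ->; rewrite mulr0.
Qed.

Lemma qvalid_norm own rs psi : qvalid_from own rs ->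
  \sum_z sqmod (foldl (fun psi r => qapply (q_U r) psi) psi rs z) =
  \sum_z sqmod (psi z).
Proof.
by elim: rs own psi => //= r rs IH own psi [Uu _ _ /IH->]; rewrite unitary_norm.
Qed.

Lemma qinit_norm (x y : bits n) :
  \sum_(z : conf) sqmod (qinit R x y z) = 1.
Proof.
rewrite (bigD1 (qinit_conf ka kb x y))//= /qinit eqxx big1 => [|z /negPf->].
  by rewrite -[_%:R]/(1%:C%C) sqmod_real expr1n addr0.
by rewrite -[_%:R]/(0%:C%C) sqmod_real expr0n.
Qed.

Lemma qfinal_norm (p : qprot R n ka kb) x y : qvalid p ->
  \sum_z sqmod (qfinal p x y z) = 1.
Proof. by move=> /qvalid_norm->; rewrite qinit_norm. Qed.

Lemma qpcorrect_le1 f (p : qprot R n ka kb) x y : qvalid p ->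
  qpcorrect f p x y <= 1.
Proof.
move=> pv; rewrite -(qfinal_norm x y pv) /qpcorrect big_mkcond ler_sum// => z _.
by case: ifP; rewrite ?sqmod_ge0.
Qed.

Lemma qpcorrectE f (p : qprot R n ka kb) x y : qvalid p ->
  qpcorrect f p x y * 2 - 1 =
  (-1) ^+ f x y * \sum_z sqmod (qfinal p x y z) * (-1) ^+ z (q_out p).
Proof.
move=> pv; rewrite -[X in _ - X = _](qfinal_norm x y pv).
rewrite /qpcorrect big_mkcond mulr_suml -sumrB mulr_sumr.
apply: eq_bigr => z _; set s := sqmod _.
by case: (z _) (f x y) => -[]/=; rewrite ?expr0 ?expr1; ring.
Qed.

(** If [z] and [z'] differ somewhere off [S], so do [w] and [w'], and both entries vanish; otherwise
    the invariance for [S] applies. *)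
Lemma acts_only_on_sub (S S' : pred qb) U : {subset S <= S'} ->
  acts_only_on S U -> acts_only_on S' U.
Proof.
move=> SS' [U0 US]; split=> [z z' [q [S'q zq]]|z z' w w' zw zz'].
  by apply: U0; exists q; split=> //; apply: contra S'q; exact: SS'.
have [[q [Sq zq]]|nS] := pselect (exists q, ~~ S q /\ z q != z' q).
  rewrite !U0//; exists q; split=> //.
  have [S'q|/zz'[zz'q]] := boolP (S' q); last by rewrite zz'q eqxx in zq.
  by have [<- <-] := zw q S'q.
apply: US => q Sq; first exact/zw/SS'.
have zq : z q = z' q by apply/eqP/negP => /negP h; apply: nS; exists q.
split=> //; have [/zw[<- <-]//|/zz'[]//] := boolP (S' q).
Qed.

Definition idop : op := fun z z' => (z == z')%:R.

Lemma qapply_id psi : qapply idop psi = psi.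
Proof.
apply/funext => z; rewrite /qapply (bigD1 z)//= /idop eqxx mul1r.
by rewrite big1 ?addr0// => u /negPf; rewrite eq_sym => ->; rewrite mul0r.
Qed.

Lemma unitary_id : unitary idop.
Proof.
move=> z z'; rewrite (bigD1 z)//= /idop eqxx conjC1 mul1r.
by rewrite big1 ?addr0// => u /negPf->; rewrite conjC0 mul0r.
Qed.

Lemma acts_only_on_id S : acts_only_on S idop.
Proof.
split=> [z z' [q [_ zq]]|z z' w w' zw zz']; rewrite /idop.
  by have [zz'|//] := eqVneq z z'; rewrite zz' eqxx in zq.
congr (nat_of_bool _)%:R; apply/eqP/eqP => /ffunP zE; apply/ffunP => q;
  have [/zw[zq z'q]|/zz'[]//] := boolP (S q); by move: (zE q); rewrite ?zq ?z'q.
Qed.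

Definition flip q z : conf := [ffun q' => (q' == q) (+) z q'].

Lemma flipK q : involutive (flip q).
Proof. by move=> z; apply/ffunP => q'; rewrite !ffunE addbA addbb. Qed.

Lemma flip_same q z : flip q z q = ~~ z q.
Proof. by rewrite ffunE eqxx. Qed.

Lemma flip_diff q q' z : q' != q -> flip q z q' = z q'.
Proof. by rewrite ffunE => /negPf->. Qed.

Lemma flip_neq q z : (flip q z == z) = false.
Proof. by apply/eqP => /ffunP/(_ q); rewrite flip_same; case: (z q). Qed.

(* The rotation of qubit [q] that takes |0> to a state whose measured sign has
   mean [e z]; the angle may depend on the other qubits. *)
Definition gate q (e : conf -> R) : op := fun z z' =>
  (if z' == z then Num.sqrt ((1 + e z) / 2)
   else if z' == flip q z then - (-1) ^+ z q * Num.sqrt ((1 - e z) / 2)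
   else 0)%:C%C.

Section Gate.
Variables (q : qb) (e : conf -> R).

Lemma qapply_gate psi z : qapply (gate q e) psi z =
  (Num.sqrt ((1 + e z) / 2))%:C%C * psi z +
  (- (-1) ^+ z q * Num.sqrt ((1 - e z) / 2))%:C%C * psi (flip q z).
Proof.
rewrite /qapply (bigD1 z)//= (bigD1 (flip q z)) ?flip_neq//= /gate !eqxx flip_neq.
rewrite big1 ?addr0// => z' /andP[/negPf-> /negPf->].
by rewrite rmorph0 mul0r.
Qed.

Hypothesis e1 : forall z, `|e z| <= 1.
Hypothesis e_flip : forall z, e (flip q z) = e z.

Lemma sqr_gateD z : Num.sqrt ((1 + e z) / 2) ^+ 2 = (1 + e z) / 2.
Proof. by have := e1 z; rewrite ler_norml => /andP[? ?]; rewrite sqr_sqrtr; lra. Qed.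

Lemma sqr_gateB z : Num.sqrt ((1 - e z) / 2) ^+ 2 = (1 - e z) / 2.
Proof. by have := e1 z; rewrite ler_norml => /andP[? ?]; rewrite sqr_sqrtr; lra. Qed.

(** As [e] ignores qubit [q], the gate splits into 2 by 2 rotations on the pairs [z], [flip q z]:
    the squared entries add up to 1 and the cross terms cancel by their opposite signs. *)
Lemma unitary_gate : unitary (gate q e).
Proof.
move=> z z'; have conjR (r : R) : (r%:C%C)^* = r%:C%C by exact: conjc_real.
rewrite (bigD1 z)//= (bigD1 (flip q z)) ?flip_neq//= big1 => [|u /andP[uz ufz]].
  rewrite /gate flipK !eqxx [z == flip q z]eq_sym flip_neq !conjR -!rmorphM addr0 -rmorphD.
  rewrite !e_flip flip_same [z' == z]eq_sym.
  have [<-|zz'] := eqVneq z z'.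
    rewrite [z == flip q z]eq_sym flip_neq -!expr2 sqr_gateD exprMn sqrrN sqrr_sign.
    by rewrite sqr_gateB mul1r [RHS](_ : _ = 1%:C%C)//; congr _%:C%C; field.
  rewrite [RHS](_ : _ = 0%:C%C)//; congr _%:C%C.
  case: (z' == flip q z); last by rewrite !mulr0 addr0.
  by rewrite signrN; move: (Num.sqrt _) (Num.sqrt _) ((-1) ^+ _) => c s t; ring.
rewrite /gate eq_sym (negPf uz) (_ : z == flip q u = false) ?conjR ?rmorph0 ?mul0r//.
by apply/eqP => zE; rewrite zE flipK eqxx in ufz.
Qed.

Lemma acts_only_on_gate (S : pred qb) : S q ->
    (forall z w, (forall q', S q' -> z q' = w q') -> e z = e w) ->
  acts_only_on S (gate q e).
Proof.
move=> Sq eS; split=> [z z' [q' [Sq' zq']]|z z' w w' zw zz'].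
  rewrite /gate; have [z'E|_] := eqVneq z' z; first by rewrite z'E eqxx in zq'.
  have [z'E|//] := eqVneq z' (flip q z); rewrite z'E flip_diff ?eqxx// in zq'.
  by apply: contra Sq' => /eqP->.
rewrite /gate (eS z w) => [|q' /zw[]//]; have [<- _] := zw q Sq.
have -> : (z' == z) = (w' == w).
  apply/eqP/eqP => /ffunP zE; apply/ffunP => q';
    by have [/zw[zq z'q]|/zz'[]//] := boolP (S q'); move: (zE q'); rewrite ?zq ?z'q.
suff -> : (z' == flip q z) = (w' == flip q w) by [].
apply/eqP/eqP => /ffunP zE; apply/ffunP => q'; move: (zE q'); rewrite !ffunE;
  have [/zw[-> ->]//|Sq'] := boolP (S q'); have [-> ->] := zz' q' Sq';
  by case: eqP Sq' => [->|//]; rewrite Sq.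
Qed.

(** The gate splits a weight at [q] = 0 into [(1 + e) / 2] and [(1 - e) / 2], whose difference is
    [e]. The factor [h] carries the mean contributed by a later gate. *)
Lemma gate_mean psi (h : conf -> R) :
    (forall z, z q -> psi z = 0) -> (forall z, h (flip q z) = h z) ->
  \sum_z sqmod (qapply (gate q e) psi z) * ((-1) ^+ z q * h z) =
  \sum_z sqmod (psi z) * (e z * h z).
Proof.
move=> psi0 hf.
rewrite (bigID (fun z => z q))/= (reindex_inj (can_inj (flipK q)))/=.
rewrite [RHS](bigID (fun z => z q))/= [X in _ = X + _]big1 => [|z zq]; last first.
  by rewrite psi0// -[0]/(0%:C%C) sqmod_real expr0n mul0r.
rewrite add0r; under eq_bigl => z do rewrite flip_same.
rewrite -big_split; apply: eq_bigr => z zq /=.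
rewrite !qapply_gate flipK !e_flip hf flip_same (negPf zq) (psi0 (flip q z)) ?flip_same//.
rewrite !mulr0 addr0 add0r !sqmodM !sqmod_real exprMn sqrrN sqrr_sign.
by rewrite sqr_gateD sqr_gateB expr0 expr1; field.
Qed.

End Gate.

Definition toggle (own : qb -> bool) (q0 q : qb) :=
  if q == q0 then ~~ own q else own q.

Definition own_after (own : qb -> bool) (rs : seq (qround R n ka kb)) :=
  foldl (fun o r => toggle o (q_sent r)) own rs.

Lemma qvalid_from_cat own rs rs' : qvalid_from own rs ->
  qvalid_from (own_after own rs) rs' -> qvalid_from own (rs ++ rs').
Proof. by elim: rs own => //= r rs IH own [? ? ? vrs] /(IH _ vrs). Qed.

Lemma own_afterE own rs q : uniq [seq q_sent r | r <- rs] ->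
  own_after own rs q = (q \in [seq q_sent r | r <- rs]) (+) own q.
Proof.
elim: rs own => //= r rs IH own /andP[rN urs]; rewrite IH// inE /toggle.
by case: eqP rN => [->|_ _] /=; [move/negPf->|].
Qed.

Definition send_all (s : bool) (U : qb -> op) (qs : seq qb) :=
  [seq QRound s (U q) q | q <- qs].

Lemma sent_send_all s (U : qb -> op) qs : [seq q_sent r | r <- send_all s U qs] = qs.
Proof. by rewrite -map_comp map_id. Qed.

(** The qubits are distinct, so each still belongs to the speaker when its turn comes. *)
Lemma qvalid_send_all own s (U : qb -> op) qs : uniq qs -> {in qs, forall q, own q = s} ->
    (forall q, unitary (U q)) -> (forall q, acts_only_on (pred1 q) (U q)) ->
  qvalid_from own (send_all s U qs).
Proof.
move=> + + Uu Ua; elim: qs own => //= q qs IH own /andP[qN uqs] ownq.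
have sq : own q = s by apply: ownq; rewrite mem_head.
split=> //; first by apply: acts_only_on_sub (Ua q) => q' /eqP->; apply/eqP.
apply: IH => // q' q'qs; case: eqP q'qs => [->|_ q'qs]; first by rewrite (negPf qN).
by apply: ownq; rewrite inE q'qs orbT.
Qed.

Section Uniform.
Variable z0 : conf.

(** For distinct [qs], the equal superposition on [qs] tensored with the basis state [z0] elsewhere;
    the boolean is a multiplicity 0 or 1. *)
Definition uniform_on (qs : seq qb) : conf -> C := fun z =>
  (Num.sqrt (1 / 2) ^+ size qs *+ [forall q, (q \notin qs) ==> (z q == z0 q)])%:C%C.

Lemma uniform_onP qs z : uniform_on qs z != 0 -> {in predC (mem qs), z =1 z0}.
Proof.
rewrite /uniform_on; case: forallP => [zP _ q|]; last by rewrite eqxx.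
by move=> /= qN; apply/eqP; apply: (implyP (zP q)).
Qed.

(** With mean 0 the gate takes |0> to two equal positive amplitudes, and a fresh [q] is still in
    state |0>. *)
Lemma gate_uniform_on qs q : q \notin qs -> z0 q = false ->
  qapply (gate q (fun=> 0)) (uniform_on qs) = uniform_on (q :: qs).
Proof.
move=> qN z0q; apply/funext => z; rewrite qapply_gate addr0 subr0.
have pin w : w q -> uniform_on qs w = 0.
  move=> wq; apply/eqP/negPn/negP => /uniform_onP/(_ q qN).
  by rewrite wq z0q.
have pinE w w' : (forall q', q' != q -> w q' = w' q') -> w q = false ->
    uniform_on (q :: qs) w' = (Num.sqrt (1 / 2))%:C%C * uniform_on qs w.
  move=> ww' wq; rewrite /uniform_on -rmorphM /= mulrnAr -exprS; congr (_ *+ _)%:C%C.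
  congr nat_of_bool; apply: eq_forallb => q'; rewrite inE negb_or.
  have [->|q'q] := eqVneq q' q; first by rewrite wq z0q eqxx implybT.
  by rewrite ww'.
case zq : (z q).
  rewrite pin// mulr0 add0r expr1 opprK mul1r (pinE (flip q z) z)// => [q' q'q|].
    by rewrite flip_diff.
  by rewrite flip_same zq.
by rewrite (pin (flip q z)) ?flip_same ?zq// mulr0 addr0 -(pinE z z).
Qed.

Lemma run_uniform_on acc qs : uniq qs -> {in qs, forall q, q \notin acc} ->
    {in qs, forall q, z0 q = false} ->
  foldl (fun psi r => qapply (q_U r) psi) (uniform_on acc)
    (send_all false (fun q => gate q (fun=> 0)) qs) = uniform_on (catrev qs acc).
Proof.
elim: qs acc => //= q qs IH acc /andP[qN uqs] qsN z0q.
rewrite gate_uniform_on ?qsN ?z0q ?mem_head// IH// => q' q'qs.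
  rewrite inE negb_or qsN ?inE ?q'qs ?orbT// andbT.
  by apply: contra qN => /eqP <-.
by rewrite z0q// inE q'qs orbT.
Qed.

End Uniform.

Lemma run_send_id s qs psi :
  foldl (fun psi r => qapply (q_U r) psi) psi (send_all s (fun=> idop) qs) = psi.
Proof. by elim: qs psi => //= q qs IH psi; rewrite qapply_id IH. Qed.

End QuantumBasics.

(** * From bilinear forms to quantum protocols *)

Section BilinearToQuantum.
Variables (R : realType) (n m : nat) (I : finType).
Variables (a b : bits n -> I -> R) (phi : {ffun 'I_m -> bool} -> I).
Hypotheses (a1 : forall x i, `|a x i| <= 1) (b1 : forall y i, `|b y i| <= 1).
Local Notation qb := (qubit n 1 m.+1).
Local Notation conf := (qconf n 1 m.+1).
Implicit Types (z w : conf) (q : qb).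

(** Work qubits follow the [n] input qubits: Bob's first [m] hold the index and his last one the
    output; Alice's only one holds her sign. *)
Definition index_qubit (t : 'I_m) : qb := inr (rshift n (widen_ord (leqnSn m) t)).
Definition sign_qubit : qb := inl (rshift n ord0).
Definition output_qubit : qb := inr (rshift n ord_max).
Definition index_qubits : seq qb := [seq index_qubit t | t <- enum 'I_m].

Definition alice_input z : bits n := [tuple z (inl (lshift 1 i)) | i < n].
Definition bob_input z : bits n := [tuple z (inr (lshift m.+1 i)) | i < n].
Definition index_of z : I := phi [ffun t => z (index_qubit t)].

Definition sign_mean z : R := a (alice_input z) (index_of z).
Definition output_mean z : R :=
  (-1) ^+ z sign_qubit * b (bob_input z) (index_of z).

(* Bob sends a uniformly random index to Alice, who sends back a sign of mean
   [a x i] together with the index; Bob outputs a sign whose mean is the received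
   sign times [b y i]. *)
Definition bilinear_qprot : qprot R n 1 m.+1 := QProt
  (send_all false (fun q => gate q (fun=> 0)) index_qubits ++
   QRound true (gate sign_qubit sign_mean) sign_qubit ::
   send_all true (fun=> @idop R n 1 m.+1) index_qubits ++
   [:: QRound false (gate output_qubit output_mean) output_qubit]) output_qubit.

(** The index travels both ways, since a gate may read only qubits of its speaker. The output qubit
    is sent too, because a unitary is applied only as part of a sending round. *)
Lemma qcomm_bilinear : qcomm bilinear_qprot = m.*2.+2.
Proof.
by rewrite /qcomm /= size_cat /= size_cat /send_all !size_map /= -enumT size_enum_ord; lia.
Qed.

Lemma index_qubit_inj : injective index_qubit.
Proof. by move=> t t' [] /addnI /val_inj. Qed.

Lemma uniq_index_qubits : uniq index_qubits.
Proof. by rewrite map_inj_uniq ?enum_uniq//; exact: index_qubit_inj. Qed.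

Lemma mem_index_qubit t : index_qubit t \in index_qubits.
Proof. by apply: map_f; rewrite mem_enum. Qed.

Lemma index_qubit_ord j : inr j \in index_qubits -> (n <= j < n + m)%N.
Proof. by case/mapP => t _ [->] /=; rewrite leq_addr ltn_add2l ltn_ord. Qed.

Lemma inl_index_qubit j : (inl j \in index_qubits) = false.
Proof. by apply/negP => /mapP[]. Qed.

Lemma output_index_qubit : (output_qubit \in index_qubits) = false.
Proof. by apply/negP => /index_qubit_ord /=; rewrite ltnn andbF. Qed.

Lemma lshift_index_qubit j : (inr (lshift m.+1 j) \in index_qubits) = false.
Proof. by apply/negP => /index_qubit_ord /=; rewrite leqNgt ltn_ord. Qed.

Lemma lshift_output j : (inr (lshift m.+1 j) == output_qubit) = false.
Proof. by apply/eqP => -[] jE; have := ltn_ord j; rewrite jE; lia. Qed.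

Lemma lshift_sign j : (inl (lshift 1 j) == sign_qubit) = false.
Proof. by apply/eqP => -[] jE; have := ltn_ord j; rewrite jE; lia. Qed.

Lemma index_output t : (index_qubit t == output_qubit) = false.
Proof. by apply/negP => /eqP oE; move: (mem_index_qubit t); rewrite oE output_index_qubit. Qed.

Lemma alice_input_ext z w : (forall j, z (inl (lshift 1 j)) = w (inl (lshift 1 j))) ->
  alice_input z = alice_input w.
Proof. by move=> zw; apply: eq_from_tnth => j; rewrite !tnth_mktuple. Qed.

Lemma bob_input_ext z w :
    (forall j, z (inr (lshift m.+1 j)) = w (inr (lshift m.+1 j))) ->
  bob_input z = bob_input w.
Proof. by move=> zw; apply: eq_from_tnth => j; rewrite !tnth_mktuple. Qed.

Lemma index_of_ext z w : (forall t, z (index_qubit t) = w (index_qubit t)) ->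
  index_of z = index_of w.
Proof. by move=> zw; congr phi; apply/ffunP => t; rewrite !ffunE. Qed.

Lemma sign_mean_le1 z : `|sign_mean z| <= 1. Proof. exact: a1. Qed.

Lemma output_mean_le1 z : `|output_mean z| <= 1.
Proof. by rewrite normrM normrX normrN1 expr1n mul1r b1. Qed.

Lemma index_of_flip_sign z : index_of (flip sign_qubit z) = index_of z.
Proof. by apply: index_of_ext => t; rewrite flip_diff. Qed.

Lemma sign_mean_flip z : sign_mean (flip sign_qubit z) = sign_mean z.
Proof.
rewrite /sign_mean index_of_flip_sign (@alice_input_ext (flip _ z) z)// => j.
by rewrite flip_diff// lshift_sign.
Qed.

Lemma output_mean_flip z : output_mean (flip output_qubit z) = output_mean z.
Proof.
rewrite /output_mean flip_diff// (@bob_input_ext (flip _ z) z) => [|j].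
  by rewrite (@index_of_ext (flip _ z) z)// => t; rewrite flip_diff// index_output.
by rewrite flip_diff// lshift_output.
Qed.

Lemma qvalid_bilinear : qvalid bilinear_qprot.
Proof.
have gate0u q : unitary (gate q (fun=> 0)).
  by apply: unitary_gate => // z; rewrite normr0.
have gate0a q : acts_only_on (pred1 q) (gate q (fun=> 0)).
  by apply: acts_only_on_gate => //=.
apply: qvalid_from_cat.
  apply: qvalid_send_all => //; first exact: uniq_index_qubits.
  by move=> _ /mapP[t _ ->].
(* The index qubits are now Alice's, so her gate may read them. *)
set own1 := own_after _ _.
have own1E q : own1 q = (q \in index_qubits) (+) owner0 q.
  by rewrite /own1 own_afterE sent_send_all// uniq_index_qubits.
split=> /=.
- by apply: unitary_gate; [exact: sign_mean_le1|exact: sign_mean_flip].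
- apply: acts_only_on_gate => /= [|z w zw]; first by rewrite own1E inl_index_qubit.
  rewrite /sign_mean (@alice_input_ext z w) => [|j]; last first.
    by apply: zw; rewrite own1E inl_index_qubit.
  by rewrite (@index_of_ext z w)// => t; apply: zw; rewrite own1E mem_index_qubit.
- by rewrite own1E inl_index_qubit.
set own2 := fun q => _.
have own2E q : own2 q = (q == sign_qubit) (+) ((q \in index_qubits) (+) owner0 q).
  by rewrite /own2 !own1E; case: ifP.
apply: qvalid_from_cat.
  apply: qvalid_send_all => //; first exact: uniq_index_qubits.
  - by move=> _ /mapP[t _ ->]; rewrite own2E mem_index_qubit.
  - by move=> q; exact: unitary_id.
  - by move=> q; exact: acts_only_on_id.
(* Bob now holds the index and the sign qubit, hence all that his last gate reads. *)
set own3 := own_after _ _.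
have own3E q : own3 q = (q == sign_qubit) (+) owner0 q.
  rewrite /own3 own_afterE sent_send_all ?uniq_index_qubits// own2E.
  by case: (q \in _) (q == _) (owner0 q) => -[] -[].
split=> //=.
- by apply: unitary_gate; [exact: output_mean_le1|exact: output_mean_flip].
- apply: acts_only_on_gate => /= [|z w zw]; first by rewrite own3E.
  rewrite /output_mean zw ?own3E ?eqxx// (@bob_input_ext z w) => [|j]; last first.
    by apply: zw; rewrite own3E.
  by rewrite (@index_of_ext z w)// => t; apply: zw; rewrite own3E.
Qed.

(** The gates are averaged out from the last to the first: the output sign becomes the received sign
    times [b], then that sign becomes [a]. What remains is an average over the uniform index. *)
Lemma bilinear_qprot_bias (x y : bits n) : bijective phi ->
  \sum_z sqmod (qfinal bilinear_qprot x y z) * (-1) ^+ z output_qubit =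
  (\sum_i a x i * b y i) / 2 ^+ m.
Proof.
move=> phi_bij; set z0 := qinit_conf 1 m.+1 x y.
have z0hi : {in index_qubits, forall q, z0 q = false}.
  move=> _ /mapP[t _ ->]; rewrite ffunE /= nth_default// size_tuple.
  exact: leq_addr.
have z0sign : z0 sign_qubit = false by rewrite ffunE /= nth_default// size_tuple addn0.
have z0out : z0 output_qubit = false.
  by rewrite ffunE /= nth_default// size_tuple leq_addr.
pose psi := uniform_on R z0 (catrev index_qubits [::]).
have psi0 q : q \notin index_qubits -> z0 q = false -> forall z, z q -> psi z = 0.
  move=> qN z0q z zq; apply/eqP/negPn/negP => /uniform_onP/(_ q).
  by rewrite inE /= catrevE cats0 mem_rev zq z0q => /(_ qN).
(* The rounds returning the index apply the identity and drop out. *)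
have -> : qfinal bilinear_qprot x y =
    qapply (gate output_qubit output_mean) (qapply (gate sign_qubit sign_mean) psi).
  rewrite /qfinal /= foldl_cat /= foldl_cat /= run_send_id.
  have -> : qinit R x y = uniform_on R z0 [::].
    apply/funext => z; rewrite /uniform_on expr0 -/z0.
    have -> : [forall q, (q \notin [::]) ==> (z q == z0 q)] = (z == z0).
      by apply/forallP/eqP => [zz|-> q]; [apply/ffunP => q; apply/eqP/zz|rewrite eqxx].
    by rewrite /qinit -/z0; case: eqP.
  by rewrite run_uniform_on// uniq_index_qubits.
have := @gate_mean R n 1 m.+1 output_qubit output_mean output_mean_le1 output_mean_flip
  (qapply (gate sign_qubit sign_mean) psi) (fun=> 1).
under eq_bigr => z _ do rewrite mulr1; move=> ->//; last first.
  move=> z zq; rewrite qapply_gate !(psi0 output_qubit) ?output_index_qubit//.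
    by rewrite !mulr0 addr0.
  by rewrite flip_diff.
under eq_bigr => z _ do rewrite mulr1.
(* Here [h] is the factor [b], which does not read the sign qubit. *)
rewrite gate_mean; first last.
- move=> z; rewrite index_of_flip_sign (@bob_input_ext (flip _ z) z)// => j.
  by rewrite flip_diff.
- by apply: psi0; rewrite ?inl_index_qubit.
- exact: sign_mean_flip.
- exact: sign_mean_le1.
(* The configurations [ext i] are those on which [psi] has its amplitude. *)
pose ext (i : {ffun 'I_m -> bool}) : conf :=
  [ffun q => if q \in index_qubits then
     (if [pick t | index_qubit t == q] is Some t then i t else false) else z0 q].
have extE i t : ext i (index_qubit t) = i t.
  rewrite ffunE mem_index_qubit; case: pickP => [t' /eqP/index_qubit_inj->//|].
  by move/(_ t); rewrite eqxx.
have ext0 i q : q \notin index_qubits -> ext i q = z0 q by rewrite ffunE => /negPf->.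
rewrite mulr_suml (reindex phi)/=; last exact: onW_bij.
transitivity (\sum_i sqmod (psi (ext i)) *
   (sign_mean (ext i) * b (bob_input (ext i)) (index_of (ext i)))).
  pose pin z := [forall q, (q \notin index_qubits) ==> (z q == z0 q)].
  rewrite (bigID pin)/=.
  rewrite [X in _ + X]big1 ?addr0 => [|z zN]; last first.
    have -> : psi z = 0; last by rewrite -[0]/(0%:C%C) sqmod_real expr0n mul0r.
    apply/eqP/negPn/negP => /uniform_onP zP; move/negP: zN; apply.
    apply/forallP => q; apply/implyP => qN; apply/eqP/zP.
    by rewrite inE /= catrevE cats0 mem_rev.
  rewrite (reindex_onto ext (fun z => [ffun t => z (index_qubit t)]))/=.
    apply: eq_bigl => i; rewrite (_ : [ffun t => _] = i) ?eqxx ?andbT.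
      by apply/forallP => q; apply/implyP => qN; rewrite ext0.
    by apply/ffunP => t; rewrite ffunE extE.
  move=> z /forallP zP; apply/ffunP => q.
  have [/mapP[t _ ->]|qN] := boolP (q \in index_qubits); first by rewrite extE ffunE.
  by rewrite ext0//; apply/esym/eqP; exact: (implyP (zP q)).
apply: eq_bigr => i _.
have -> : sqmod (psi (ext i)) = (2 ^+ m)^-1.
  rewrite /psi /uniform_on catrevE cats0 size_rev size_map size_enum_ord.
  have -> : [forall q, (q \notin rev index_qubits) ==> (ext i q == z0 q)].
    by apply/forallP => q; apply/implyP; rewrite mem_rev => qN; rewrite ext0.
  by rewrite sqmod_real exprAC sqr_sqrtr ?divr_ge0// div1r exprVn.
rewrite mulrC; congr (_ * _); rewrite /sign_mean.
have -> : index_of (ext i) = phi i.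
  by congr phi; apply/ffunP => t; rewrite ffunE extE.
have -> : alice_input (ext i) = x.
  apply: eq_from_tnth => j; rewrite tnth_mktuple ext0 ?inl_index_qubit// ffunE.
  by rewrite (tnth_nth false).
have -> : bob_input (ext i) = y.
  apply: eq_from_tnth => j; rewrite tnth_mktuple ext0 ?lshift_index_qubit// ffunE.
  by rewrite (tnth_nth false).
by [].
Qed.

End BilinearToQuantum.

(** A rotation realises any mean in [-1, 1] exactly, so no rounding loss occurs here. *)
Lemma bilinear_quantum (R : realType) n (f : bits n -> bits n -> bool)
    (I : finType) m (th : R) : #|I| = (2 ^ m)%N -> bilinear f I th ->
  exists ka kb (p : qprot R n ka kb),
    [/\ qvalid p, qcomm p = m.*2.+2 &
        forall x y, 1 / 2 + th / 2 ^+ m.+1 <= qpcorrect f p x y].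
Proof.
move=> cardI [a [b [a1 b1 ab]]].
have [phi phi_bij] : exists g : {ffun 'I_m -> bool} -> I, bijective g.
  by apply: card_eq_bij; rewrite card_ffun card_bool card_ord.
exists 1%N, m.+1, (bilinear_qprot a b phi).
have pV := qvalid_bilinear phi a1 b1.
split=> [//||x y]; first exact: qcomm_bilinear.
rewrite -(ler_pM2r (ltr0n R 2)) -(lerD2r (-1)) qpcorrectE// bilinear_qprot_bias// mulrA.
have -> : (1 / 2 + th / 2 ^+ m.+1) * 2 - 1 = th / 2 ^+ m.
  by rewrite exprS; field; rewrite expf_neq0// pnatr_eq0.
by rewrite ler_pM2r ?invr_gt0 ?exprn_gt0.
Qed.

(** * From quantum protocols to bilinear forms *)

Section QuantumToBilinear.
Variables (R : realType) (n ka kb : nat).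
Local Notation C := R[i].
Local Notation qb := (qubit n ka kb).
Local Notation conf := (qconf n ka kb).
Local Notation op := (qop R n ka kb).
Implicit Types (U : op) (A B : conf -> C) (z u v w : conf) (q : qb) (S : pred qb).

(** A configuration of the qubits in [S] is encoded as a full one that is 0 off [S], so local states
    keep one type while ownership changes. *)
Definition mask S z : conf := [ffun q => S q && z q].
Definition splice S u z : conf := [ffun q => if S q then u q else z q].
Definition setq q (b : bool) z : conf := [ffun q' => if q' == q then b else z q'].

Lemma mask_splice S u z : mask S (splice S u z) = mask S u.
Proof. by apply/ffunP => q; rewrite !ffunE; case: (S q). Qed.

Lemma maskC_splice S u z : mask (predC S) (splice S u z) = mask (predC S) z.
Proof. by apply/ffunP => q; rewrite !ffunE /=; case: (S q). Qed.

Lemma splice_mask S z : splice S (mask S z) (mask (predC S) z) = z.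
Proof. by apply/ffunP => q; rewrite !ffunE /=; case: (S q). Qed.

Lemma eq_mask S S' z : S =1 S' -> mask S z = mask S' z.
Proof. by move=> SS'; apply/ffunP => q; rewrite !ffunE SS'. Qed.

Lemma sum_mask (K : pzRingType) S (F G : conf -> K) :
  \sum_z F (mask S z) * G (mask (predC S) z) =
  (\sum_(u | mask S u == u) F u) * (\sum_(v | mask (predC S) v == v) G v).
Proof.
rewrite big_distrlr pair_big_dep /=.
rewrite [RHS](reindex_onto (fun z => (mask S z, mask (predC S) z))
                           (fun p => splice S p.1 p.2))/=.
  apply: eq_bigl => z; rewrite splice_mask eqxx andbT; apply/esym/andP.
  by split; apply/eqP/ffunP => q; rewrite !ffunE /=; case: (S q).
by move=> [u v] /andP[/eqP uE /eqP vE]; rewrite mask_splice maskC_splice uE vE.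
Qed.

(** [U] does not connect configurations that differ off [S], so the factor [B] is untouched; the
    invariance clause of [acts_only_on] moves the entries of [U] to masked configurations. *)
Lemma qapply_local S U A B z : acts_only_on S U ->
  qapply U (fun w => A (mask S w) * B (mask (predC S) w)) z =
  qapply U A (mask S z) * B (mask (predC S) z).
Proof.
move=> [U0 US]; rewrite /qapply mulr_suml.
(* Only [w] that agree with [z] off [S] contribute. *)
rewrite (bigID (fun w => splice S w z == w))/= [X in _ + X]big1 ?addr0; last first.
  move=> w wz; rewrite U0 ?mul0r//.
  have [q wq] : exists q, splice S w z q != w q.
    by apply/existsP; rewrite -negb_forall; apply: contra wz => /forallP h;
       apply/eqP/ffunP => q; apply/eqP.
  by exists q; move: wq; rewrite ffunE; case: (S q); rewrite ?eqxx.
rewrite [RHS](bigID (fun u => mask S u == u))/= [X in _ = _ + X]big1 ?addr0; last first.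
  move=> u uS; rewrite U0 ?mul0r//.
  have [q uq] : exists q, mask S u q != u q.
    by apply/existsP; rewrite -negb_forall; apply: contra uS => /forallP h;
       apply/eqP/ffunP => q; apply/eqP.
  by exists q; move: uq; rewrite !ffunE; case: (S q); rewrite ?eqxx.
rewrite (reindex_onto (fun u => splice S u z) (mask S)) => [|w /eqP wE]; last first.
  by rewrite -[RHS]wE; apply/ffunP => q; rewrite !ffunE; case: (S q).
rewrite [LHS](eq_bigl (fun u => mask S u == u)) => [|u]; last first.
  rewrite mask_splice andb_idl// => _.
  by apply/eqP/ffunP => q; rewrite !ffunE; case: (S q).
apply: eq_bigr => u /eqP uE; rewrite mask_splice maskC_splice uE mulrA.
congr (_ * _ * _); apply: US => q Sq; rewrite !ffunE ?Sq ?(negPf Sq)//.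
by rewrite -uE ffunE (negPf Sq).
Qed.

(** The part of [A] at value [b'] of [q], moved to value [b]. It strips [q] from the sender's state
    ([b] false) or attaches it to the receiver's ([b'] false). *)
Definition slice q (b b' : bool) A : conf -> C :=
  fun v => if v q == b then A (setq q b' v) else 0.

Lemma slice_norm q b b' A :
  \sum_v sqmod (slice q b b' A v) <= \sum_v sqmod (A v).
Proof.
rewrite (bigID (fun v => v q == b))/= [X in _ + X]big1 ?addr0 => [|v /negPf vq]; last first.
  by rewrite /slice vq -[0]/(0%:C%C) sqmod_real expr0n.
rewrite (reindex_onto (setq q b) (setq q b')) => [|v /eqP vq]; last first.
  by apply/ffunP => q'; rewrite !ffunE; case: eqP => // ->.
rewrite big_mkcond ler_sum// => v _; case: ifP => [/andP[vq /eqP vE]|]; last first.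
  by rewrite sqmod_ge0.
by rewrite /slice vq vE.
Qed.

Definition side (own : qb -> bool) (s : bool) : pred qb := fun q => own q == s.

(* [Psi x y] is a sum of products of unnormalised states, each factor living on
   the qubits of one player and depending on the input of that player only. *)
Definition decomposes (own : qb -> bool) (I : finType)
    (V : I -> bool -> bits n -> conf -> C) (Psi : bits n -> bits n -> conf -> C) :=
  (forall i s x, \sum_z sqmod (V i s x z) <= 1) /\
  (forall x y z, Psi x y z =
     \sum_i V i true x (mask (side own true) z) * V i false y (mask (side own false) z)).

(** Sending a qubit doubles the number of terms, one for each value of that qubit. The unitary acts
    on the speaker's factors only, and neither it nor slicing increases norms. *)
Lemma decomposes_round own I V Psi (r : qround R n ka kb) :
    unitary (q_U r) -> acts_only_on (side own (q_speaker r)) (q_U r) ->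
    own (q_sent r) = q_speaker r -> @decomposes own I V Psi ->
  exists V' : I * bool -> bool -> bits n -> conf -> C,
    decomposes (toggle own (q_sent r)) V' (fun x y => qapply (q_U r) (Psi x y)).
Proof.
case: r => s U q /= Uu Ua ownq [V1 VPsi].
exists (fun ib s' x => if s' == s then slice q false ib.2 (qapply U (V ib.1 s x))
                       else slice q ib.2 false (V ib.1 s' x)).
split=> [[i b] s' x|x y z] /=.
  by case: eqP => _; apply: le_trans (slice_norm _ _ _ _) _; rewrite ?unitary_norm.
(* Indexing the inputs by player treats both speakers at once. *)
pose inp (s' : bool) := if s' then x else y.
have -> : Psi x y = fun z => \sum_i V i s (inp s) (mask (side own s) z) *
                          V i (~~ s) (inp (~~ s)) (mask (predC (side own s)) z).
  apply/funext => w; rewrite VPsi; apply: eq_bigr => i _.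
  rewrite [mask (predC _) w](@eq_mask _ (side own (~~ s))) => [|q'].
    by case: {Uu Ua ownq} s => //=; rewrite mulrC.
  by rewrite /side /=; case: (own q') s {Uu Ua ownq} => -[].
transitivity (\sum_i qapply U (V i s (inp s)) (mask (side own s) z) *
                     V i (~~ s) (inp (~~ s)) (mask (predC (side own s)) z)).
  rewrite /qapply; under eq_bigr => w _ do rewrite mulr_sumr.
  rewrite exchange_big; apply: eq_bigr => i _.
  exact: (qapply_local (V i s (inp s)) (V i (~~ s) (inp (~~ s))) z Ua).
set own' := toggle own q.
have own'q : own' q = ~~ s by rewrite /own' /toggle eqxx ownq.
have atA : mask (side own' s) z q = false.
  by rewrite ffunE /side own'q; case: (s).
have atB : mask (side own' (~~ s)) z q = z q by rewrite ffunE /side own'q eqxx.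
have setA : setq q (z q) (mask (side own' s) z) = mask (side own s) z.
  apply/ffunP => q'; rewrite !ffunE /side /own' /toggle.
  by case: eqP => // ->; rewrite ownq eqxx.
have setB : setq q false (mask (side own' (~~ s)) z) = mask (predC (side own s)) z.
  apply/ffunP => q'; rewrite !ffunE /side /own' /toggle /=; case: eqP => [->|_].
    by rewrite ownq eqxx.
  by case: (own q') s {Uu Ua ownq own'q atA atB setA} => -[].
transitivity (\sum_(ib : I * bool)
    slice q false ib.2 (qapply U (V ib.1 s (inp s))) (mask (side own' s) z) *
    slice q ib.2 false (V ib.1 (~~ s) (inp (~~ s))) (mask (side own' (~~ s)) z)).
  rewrite -(pair_bigA _ (fun i b =>
    slice q false b (qapply U (V i s (inp s))) (mask (side own' s) z) *
    slice q b false (V i (~~ s) (inp (~~ s))) (mask (side own' (~~ s)) z)))/=.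
  (* Only the term where [b] is the actual value of the sent qubit survives. *)
  apply: eq_bigr => i _; rewrite (bigD1 (z q))//= big1 ?addr0 => [|b bz]; last first.
    by rewrite {2}/slice atB eq_sym (negPf bz) mulr0.
  by rewrite /slice atA atB !eqxx setA setB.
apply: eq_bigr => -[i b] _ /=.
by rewrite /inp; case: (s) => //=; rewrite mulrC.
Qed.

Lemma decomposes_rounds rs own I V Psi : qvalid_from own rs -> @decomposes own I V Psi ->
  exists (J : finType) (W : J -> bool -> bits n -> conf -> C) own',
    #|J| = (#|I| * 2 ^ size rs)%N /\
    decomposes own' W
      (fun x y => foldl (fun psi r => qapply (q_U r) psi) (Psi x y) rs).
Proof.
elim: rs own I V Psi => [|r rs IH] own I V Psi /=.
  by move=> _ VP; exists I, V, own; rewrite muln1.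
move=> [Uu Ua ownq vrs] /(decomposes_round Uu Ua ownq)[V' /(IH _ _ _ _ vrs)].
move=> [J [W [own' [cardJ WP]]]]; exists J, W, own'; split=> //.
by rewrite cardJ card_prod card_bool expnS mulnA.
Qed.

Lemma decomposes_init : exists V : unit -> bool -> bits n -> conf -> C,
  decomposes (@owner0 n ka kb) V (fun x y => qinit R x y).
Proof.
have delta1 (w : conf) : \sum_(z : conf) sqmod ((z == w)%:R : C) <= 1.
  rewrite (bigD1 w)//= eqxx big1 => [|z /negPf->].
    by rewrite -[_%:R]/(1%:C%C) sqmod_real expr1n addr0.
  by rewrite -[_%:R]/(0%:C%C) sqmod_real expr0n.
(* The factor of player [s] sees one input only; it may fill both halves, since [mask] keeps just
   the half of [s]. *)
exists (fun _ s x z => (z == mask (side (@owner0 n ka kb) s) (qinit_conf ka kb x x))%:R).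
split=> // x y z; rewrite big_const card_unit /= addr0 /qinit -natrM mulnb.
congr (nat_of_bool _)%:R; apply/eqP/andP => [->|[/eqP/ffunP zl /eqP/ffunP zr]].
  by split; apply/eqP/ffunP => -[j|j]; rewrite !ffunE.
apply/ffunP => -[j|j]; first by move: (zl (inl j)); rewrite !ffunE.
by move: (zr (inr j)); rewrite !ffunE.
Qed.

(** The inequality of arithmetic and geometric means; summed over states of norm at most 1, it takes
    the place of Cauchy-Schwarz. *)
Lemma ReIm_cross_le (sg : bool) (c d : C) :
  `|complex.Re ((-1) ^+ sg * (c^* * d))| <= (sqmod c + sqmod d) / 2 /\
  `|complex.Im ((-1) ^+ sg * (c^* * d))| <= (sqmod c + sqmod d) / 2.
Proof.
have -> : (-1) ^+ sg = ((-1) ^+ sg)%:C%C :> C by rewrite rmorphXn rmorphN1.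
have s1 : `|(-1) ^+ sg : R| = 1 by rewrite normrX normrN1 expr1n.
case: c d => [a b] [a' b']; rewrite -[(Complex a b)^*]/(Complex a (- b)).
rewrite /sqmod /= !mul0r subr0 addr0 !normrM s1 !mul1r.
have ab (p q r s : R) : `|p * q + r * s| <= (p ^+ 2 + r ^+ 2 + (q ^+ 2 + s ^+ 2)) / 2.
  rewrite ler_norml; have := sqr_ge0 (p + q); have := sqr_ge0 (p - q).
  have := sqr_ge0 (r + s); have := sqr_ge0 (r - s); rewrite !expr2.
  by move=> h1 h2 h3 h4; apply/andP; split; lra.
split; first by have := ab a a' b b'; rewrite mulNr opprK.
by have := ab a b' (- b) a'; rewrite sqrrN [_ ^+ 2 + a' ^+ 2]addrC.
Qed.

(** The signed squared norm expands over pairs of terms of the decomposition, and each summand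
    factors into one inner product per player, because configurations split freely between the two
    sides. *)
Lemma quantum_bilinear (f : bits n -> bits n -> bool) (p : qprot R n ka kb) :
  qvalid p -> exists2 I : finType, #|I| = (2 ^ (qcomm p).*2.+1)%N &
    bilinear f I (wdelta (qpcorrect f p) * 2).
Proof.
move=> pV; have [V0 V0P] := decomposes_init.
have [J [V [own [cardJ [V1 VPsi]]]]] := decomposes_rounds pV V0P.
rewrite card_unit mul1n -/(qcomm p) in cardJ.
pose o := q_out p.
(* The measured sign is credited to the final owner of the output qubit. *)
pose sg s u := (own o == s) && u o.
pose k s x (ij : J * J) : C := \sum_(u | mask (side own s) u == u)
  (-1) ^+ sg s u * ((V ij.1 s x u)^* * V ij.2 s x u).
have k1 s x ij : `|complex.Re (k s x ij)| <= 1 /\ `|complex.Im (k s x ij)| <= 1.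
  have tot : \sum_u (sqmod (V ij.1 s x u) + sqmod (V ij.2 s x u)) / 2 <= 1.
    by rewrite -mulr_suml big_split /=; have := V1 ij.1 s x; have := V1 ij.2 s x; lra.
  have -> : k s x ij = \sum_(u | mask (side own s) u == u)
    (-1) ^+ sg s u * ((V ij.1 s x u)^* * V ij.2 s x u) by [].
  rewrite (big_morph (@complex.Re R) (id1 := 0) (op1 := +%R))// => [|[? ?] [? ?]//].
  rewrite (big_morph (@complex.Im R) (id1 := 0) (op1 := +%R))// => [|[? ?] [? ?]//].
  split; apply: le_trans (ler_norm_sum _ _ _) _; apply: le_trans tot;
    rewrite big_mkcond ler_sum// => u _; case: ifP => _;
    by [apply: (ReIm_cross_le _ _ _).1|apply: (ReIm_cross_le _ _ _).2|
        rewrite divr_ge0// addr_ge0 ?sqmod_ge0].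
(* The boolean separates the two products in Re (k k') = Re k Re k' - Im k Im k', which makes the
   form real. *)
exists (J * J * bool)%type.
  by rewrite !card_prod card_bool cardJ -expnD addnn expnSr.
exists (fun x t => if t.2 then complex.Im (k true x t.1) else complex.Re (k true x t.1)).
exists (fun y t => if t.2 then - complex.Im (k false y t.1) else complex.Re (k false y t.1)).
split=> [x [ij c]|y [ij c]|x y] /=.
- by have [] := k1 true x ij; case: c.
- by have [] := k1 false y ij; case: c; rewrite ?normrN.
apply: (@le_trans _ _ (qpcorrect f p x y * 2 - 1)).
  by have := wdelta_le (qpcorrect f p) x y; lra.
rewrite qpcorrectE// le_eqVlt; apply/orP; left; apply/eqP; congr (_ * _).
have Pk : (\sum_z sqmod (qfinal p x y z) * (-1) ^+ z (q_out p))%:C%C =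
          \sum_ij k true x ij * k false y ij.
  rewrite rmorph_sum /=.
  transitivity (\sum_(ij : J * J) \sum_z
     ((-1) ^+ sg true (mask (side own true) z) *
       ((V ij.1 true x (mask (side own true) z))^* * V ij.2 true x (mask (side own true) z))) *
     ((-1) ^+ sg false (mask (predC (side own true)) z) *
       ((V ij.1 false y (mask (predC (side own true)) z))^* *
        V ij.2 false y (mask (predC (side own true)) z)))); last first.
    apply: eq_bigr => ij _.
    rewrite (sum_mask _ (fun u => (-1) ^+ sg true u * ((V ij.1 true x u)^* * V ij.2 true x u))
       (fun u => (-1) ^+ sg false u * ((V ij.1 false y u)^* * V ij.2 false y u))).
    congr (_ * _); apply: eq_bigl => u; congr (_ == _); apply: eq_mask => q.
    by rewrite /side /=; case: (own q).
  rewrite exchange_big; apply: eq_bigr => z _ /=.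
  have maskC : mask (predC (side own true)) z = mask (side own false) z.
    by apply: eq_mask => q; rewrite /side /=; case: (own q).
  rewrite maskC rmorphM /= sqmodE rmorphXn rmorphN1 /=.
  rewrite /qfinal VPsi rmorph_sum big_distrlr pair_bigA /= mulr_suml; apply: eq_bigr => -[i j] _ /=.
  have -> : (-1) ^+ z (q_out p) =
     (-1) ^+ sg true (mask (side own true) z) * (-1) ^+ sg false (mask (side own false) z) :> C.
    by rewrite /sg /o !ffunE /side; case: (own _) => /=; rewrite ?mulr1 ?mul1r.
  by rewrite rmorphM /= [X in X * _]mulrACA [LHS]mulrC [LHS]mulrACA.
move/(congr1 (@complex.Re R)): Pk => /= ->.
rewrite (big_morph (@complex.Re R) (id1 := 0) (op1 := +%R))// => [|[? ?] [? ?]//].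
rewrite -(pair_bigA _ (fun ij (c : bool) =>
  (if c then complex.Im (k true x ij) else complex.Re (k true x ij)) *
  (if c then - complex.Im (k false y ij) else complex.Re (k false y ij))))/=.
apply: eq_bigr => ij _; rewrite big_bool /=.
by case: (k true x ij) (k false y ij) => [? ?] [? ?] /=; ring.
Qed.

End QuantumToBilinear.

(** * Comparison of the costs *)

Lemma mul2_div_exp2S (R : realType) (d : R) j : d * 2 / 2 ^+ j.+1 = d / 2 ^+ j.
Proof. by rewrite exprS invfM -mulrA mulVKf ?pnatr_eq0. Qed.

Lemma classical_of_quantum (R : realType) n (f : bits n -> bits n -> bool)
    ka kb (p : qprot R n ka kb) k :
    qvalid p -> weakly_unbounded (qpcorrect f p) ->
    wcost (qcomm p) (qpcorrect f p) <= k%:Z ->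
  exists ka' kb' (p' : cprot (bits n) (bits n) (ka'.-tuple bool) (kb'.-tuple bool)),
    weakly_unbounded (cpcorrect R f p') /\
    wcost (ccomm p') (cpcorrect R f p') <= (8 * k)%:Z.
Proof.
move=> pV pW pk.
have p1 x y : qpcorrect f p x y <= 1 by exact: qpcorrect_le1.
have [I cardI fI] := quantum_bilinear f pV.
have d0 : 0 < wdelta (qpcorrect f p) * 2 by rewrite mulr_gt0// wdelta_gt0.
have [ka' [kb' [p' [p'c p'P]]]] := bilinear_classical cardI d0 fI.
exists ka', kb', p'.
have [|p'W p'k] := @wcost_le _ _ _ (cpcorrect R f p') (ccomm p') (qcomm p).*2.+2 pW p1.
  move=> x y; apply: le_trans (p'P x y).
  by rewrite mul2_div_exp2S.
split=> //; apply: le_trans p'k _.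
(* With [c] qubits and logarithmic part [L], the new cost is at most [(2 c + 2) + (2 c + 2) + L],
   and [L] is at least 1. *)
by have := floor_log_wdelta pW p1; move: pk; rewrite /wcost; lia.
Qed.

Lemma quantum_of_classical (R : realType) n (f : bits n -> bits n -> bool) ka kb
    (p : cprot (bits n) (bits n) (ka.-tuple bool) (kb.-tuple bool)) k :
    weakly_unbounded (cpcorrect R f p) ->
    wcost (ccomm p) (cpcorrect R f p) <= k%:Z ->
  exists ka' kb' (p' : qprot R n ka' kb'),
    qvalid p' /\ weakly_unbounded (qpcorrect f p') /\
    wcost (qcomm p') (qpcorrect f p') <= (8 * k)%:Z.
Proof.
move=> pW pk.
have p1 x y : cpcorrect R f p x y <= 1 by exact: cpcorrect_le1.
have cardI : #|{: (ccomm p).-tuple bool}| = (2 ^ ccomm p)%N.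
  by rewrite card_tuple card_bool.
have [ka' [kb' [p' [p'V p'c p'P]]]] :=
  bilinear_quantum cardI (classical_bilinear R f p).
exists ka', kb', p'.
have [|p'W p'k] := @wcost_le _ _ _ (qpcorrect f p') (qcomm p') (ccomm p) pW p1.
  move=> x y; apply: le_trans (p'P x y).
  by rewrite mul2_div_exp2S.
split=> //; split=> //; apply: le_trans p'k _.
(* Here the new cost is at most [(2 c + 2) + c + L], again with [L] at least 1. *)
by have := floor_log_wdelta pW p1; move: pk; rewrite p'c /wcost; lia.
Qed.

Theorem theorem8p4 (R : realType) :
  exists K : nat, (0 < K)%N /\
    forall (n : nat) (f : bits n -> bits n -> bool),
      (PC R f <= K * QC R f)%N /\ (QC R f <= K * PC R f)%N.
Proof.
exists 8%N; split=> // n f.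
have QP k : (exists ka kb (p : qprot R n ka kb), qvalid p /\
     weakly_unbounded (qpcorrect f p) /\ wcost (qcomm p) (qpcorrect f p) <= k%:Z) ->
   exists ka kb (p : cprot (bits n) (bits n) (ka.-tuple bool) (kb.-tuple bool)),
     weakly_unbounded (cpcorrect R f p) /\
     wcost (ccomm p) (cpcorrect R f p) <= (8 * k)%:Z.
  by move=> [ka [kb [p [pV [pW pk]]]]]; exact: classical_of_quantum pV pW pk.
have PQ k : (exists ka kb (p : cprot (bits n) (bits n) (ka.-tuple bool) (kb.-tuple bool)),
     weakly_unbounded (cpcorrect R f p) /\
     wcost (ccomm p) (cpcorrect R f p) <= k%:Z) ->
   exists ka kb (p : qprot R n ka kb), qvalid p /\
     weakly_unbounded (qpcorrect f p) /\
     wcost (qcomm p) (qpcorrect f p) <= (8 * k)%:Z.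
  by move=> [ka [kb [p [pW pk]]]]; exact: quantum_of_classical pW pk.
(* Each simulation serves twice: for a bound, and for the existence clause of the opposite one. *)
split; apply: natmin_leM => k.
- by move/QP => ?; exists (8 * k)%N.
- by move/PQ => ?; exists (8 * k)%N.
- by move/PQ => ?; exists (8 * k)%N.
- by move/QP => ?; exists (8 * k)%N.
Qed.
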